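(* Let $\mathbb{K}$ be a commutative ring with identity, let $(A,[-,-])$ be a Lie $\mathbb{K}$-affgebra and let $N:A\to A$ be a Nijenhuis operator on $(A,[-,-])$. Then the Nijenhuis bracket $$[a,b]_N=\langle [N(a),b],\,N([a,b]),\,[a,N(b)]\rangle,\qquad a,b\in A,$$ is a Lie bracket on the affine $\mathbb{K}$-module $A$.
   Context: An abelian heap is a set $A$ with a ternary operation $\langle -,-,-\rangle:A^3\to A$ such that for all $a,b,c,d,e\in A$: $\langle\langle a,b,c\rangle,d,e\rangle=\langle a,b,\langle c,d,e\rangle\rangle$, $\langle a,b,b\rangle=a=\langle b,b,a\rangle$, $\langle a,b,c\rangle=\langle c,b,a\rangle$. Heap homomorphisms are maps preserving the ternary operation. One writes $\langle a_1,\ldots,a_{2n+1}\rangle:=\langle\ldots\langle\langle a_1,a_2,a_3\rangle,a_4,a_5\rangle,\ldots,a_{2n+1}\rangle$. An affine $\mathbb{K}$-module ($\mathbb{K}$ a commutative ring with identity) is a non-empty abelian heap $A$ with a map $\mathbb{K}\times A\times A\to A$, $(\alpha,a,b)\mapsto\alpha\triangleright_a b$, such that for all $a,b,c\in A$, $\alpha,\beta\in\mathbb{K}$: (a) $\alpha\triangleright_a-:A\to A$ and $-\triangleright_a b:\mathbb{K}\to A$ are heap homomorphisms, where $\mathbb{K}$ is a heap via $\alpha-\beta+\gamma$; (b) $(\alpha\beta)\triangleright_a b=\alpha\triangleright_a(\beta\triangleright_a b)$; (c) $\alpha\triangleright_a b=\langle\alpha\triangleright_c b,\alpha\triangleright_c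 a,a\rangle$; (d) $0\triangleright_a b=a$ and $1\triangleright_a b=b$. A homomorphism of affine $\mathbb{K}$-modules (affine map) is a heap homomorphism $f$ with $f(\alpha\triangleright_a b)=\alpha\triangleright_{f(a)}f(b)$. A map $A\times A\to A$ is bi-affine if it is an affine map in each argument separately. A Lie bracket on an affine $\mathbb{K}$-module $A$ (by convention, a left Lie bracket) is a bi-affine map $[-,-]:A\times A\to A$ such that for all $a,b,c\in A$: $\langle [a,b],[a,a],[b,a]\rangle=[b,b]$ and $\langle [a,[b,c]],[a,a],[b,[c,a]],[b,b],[c,[a,b]]\rangle=[c,c]$. An affine $\mathbb{K}$-module with a Lie bracket is called a Lie $\mathbb{K}$-affgebra. A Nijenhuis operator on a Lie affgebra $(A,[-,-])$ is an affine map $N:A\to A$ such that for all $a,b\in A$: $[N(a),N(b)]=N\big(\langle [N(a),b],N([a,b]),[a,N(b)]\rangle\big)$. *)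

(* Defs.v *)
From HB Require Import structures.
From mathcomp Require Import all_boot all_algebra.

Set Implicit Arguments.
Unset Strict Implicit.
Unset Printing Implicit Defensive.

Import GRing.Theory.
Local Open Scope ring_scope.

Definition heap_morphism (A B : Type) (hA : A -> A -> A -> A)
    (hB : B -> B -> B -> B) (f : A -> B) : Prop :=
  forall a b c, f (hA a b c) = hB (f a) (f b) (f c).

Definition zmod_heap (V : zmodType) (a b c : V) : V := a - b + c.

(* Possibly empty: non-emptiness is only required of affine modules. *)
HB.mixin Record isAbelianHeap (A : Type) := {
  heap : A -> A -> A -> A;
  heapA : forall a b c d e, heap (heap a b c) d e = heap a b (heap c d e);
  heapKr : forall a b, heap a b b = a;
  heapKl : forall a b, heap b b a = a;
  heapC : forall a b c, heap a b c = heap c b a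
}.

#[short(type="abelianHeapType")]
HB.structure Definition AbelianHeap := { A of isAbelianHeap A }.

Definition heap5 (A : abelianHeapType) (a b c d e : A) : A :=
  heap (heap a b c) d e.

(* [act x a b] is the action of the scalar x on b with base point a. The
   scalar ring is allowed to be trivial. *)
HB.mixin Record AbelianHeap_isAffModule (K : comPzRingType) (A : Type)
    of AbelianHeap A := {
  affmod_inhabited : inhabited A;
  act : K -> A -> A -> A;
  act_heapr : forall x a, heap_morphism heap heap (act x a);
  act_heapl : forall a b,
    heap_morphism (@zmod_heap K) heap (fun x => act x a b);
  actM : forall x y a b, act (x * y) a b = act x a (act y a b);
  act_base : forall x a b c, act x a b = heap (act x c b) (act x c a) a;
  act0 : forall a b, act 0 a b = a;
  act1 : forall a b, act 1 a b = b
}.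

#[short(type="affModType")]
HB.structure Definition AffModule (K : comPzRingType) :=
  { A of AbelianHeap A & AbelianHeap_isAffModule K A }.

Section LieAffgebra.
Variable K : comPzRingType.

Definition affine_map (A B : affModType K) (f : A -> B) : Prop :=
  heap_morphism heap heap f /\
  forall (x : K) (a b : A), f (act x a b) = act x (f a) (f b).

Variable A : affModType K.
Implicit Types (br : A -> A -> A) (N : A -> A).

Definition biaffine br : Prop :=
  (forall a, affine_map (br a)) /\ (forall b, affine_map (fun a => br a b)).

Definition lie_bracket br : Prop :=
  [/\ biaffine br,
      forall a b, heap (br a b) (br a a) (br b a) = br b b
    & forall a b c,
        heap5 (br a (br b c)) (br a a) (br b (br c a)) (br b b)
              (br c (br a b)) = br c c].

Definition nijenhuis_bracket br N (a b : A) : A :=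
  heap (br (N a) b) (N (br a b)) (br a (N b)).

Definition nijenhuis_operator br N : Prop :=
  affine_map N /\
  forall a b, br (N a) (N b) = N (nijenhuis_bracket br N a b).

End LieAffgebra.

(* Main.v *)
(** The choice of an origin turns an abelian heap into an abelian group, in
    which a heap identity is an equation between sums of the same length.
    Write [s F] for the sum of [F] over the cyclic rotations of [(a, b, c)].
    Expanding the brackets with the Nijenhuis identity gives
      [[a,[b,c]_N]_N = [Na,[Nb,c]] + [Na,[b,Nc]] + [a,[Nb,Nc]]
         - N[Na,[b,c]] - N[a,[Nb,c]] - N[a,[b,Nc]] + NN[a,[b,c]]],
    and the Jacobi identity of the original bracket turns the cyclic sum into
      [2 s[Na,Na] + s[a,a] - s N[Na,Na] - 2 s N[a,a] + s NN[a,a]].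
    This is [s [a,a]_N = s[Na,Na] + s[a,a] - s N[a,a]], because the Nijenhuis
    identity for [(a, a)] reads [[Na,Na] = N[Na,Na] + N[a,a] - NN[a,a]]. *)
Require Import Defs.
From mathcomp Require Import all_boot all_algebra.

Set Implicit Arguments.
Unset Strict Implicit.
Unset Printing Implicit Defensive.

Section HeapRetract.
Variables (A : abelianHeapType) (o : A).

Definition hadd (x y : A) : A := heap x o y.
Local Infix "+" := hadd.

Lemma haddA : associative hadd.
Proof. by move=> x y z; rewrite /hadd heapA. Qed.

Lemma haddC : commutative hadd.
Proof. by move=> x y; rewrite /hadd heapC. Qed.

Lemma haddAC : right_commutative hadd.
Proof. by move=> x y z; rewrite -!haddA (haddC y). Qed.

Lemma haddACA : interchange hadd hadd.
Proof. by move=> x y z t; rewrite !haddA (haddAC x). Qed.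

(** Subtraction of [x] is [heap t x o]; it undoes the addition of [x]. *)
Lemma haddIr x : injective (hadd^~ x).
Proof.
move=> y z /(congr1 (fun t => heap t x o)).
by rewrite /hadd !heapA !heapKl !heapKr.
Qed.

Lemma haddB x y z : heap x y z + y = x + z.
Proof. by rewrite /hadd heapA (heapC z) -heapA heapKr. Qed.

Lemma heapP x y z w : heap x y z = w <-> x + z = w + y.
Proof.
by split=> [<-|e]; [rewrite haddB | apply: (@haddIr y); rewrite haddB].
Qed.

Lemma heap5P a b c d e w : heap5 a b c d e = w <-> a + c + e = w + b + d.
Proof.
split=> [/heapP E|E].
  by rewrite -(haddB a b c) haddAC E haddAC.
by apply/heapP/(@haddIr b); rewrite haddAC haddB E haddAC.
Qed.

Section CyclicSum.
Variables a b c : A.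

Definition cycsum (F : A -> A -> A -> A) : A := F a b c + F b c a + F c a b.

Lemma eq_cycsum F G :
  (forall x y z, F x y z = G x y z) -> cycsum F = cycsum G.
Proof. by move=> eqFG; rewrite /cycsum !eqFG. Qed.

Lemma cycsumD F G :
  cycsum (fun x y z => F x y z + G x y z) = cycsum F + cycsum G.
Proof. by rewrite /cycsum (haddACA (F a b c)) haddACA. Qed.

Lemma cycsum_rot F : cycsum (fun x y z => F y z x) = cycsum F.
Proof. by rewrite /cycsum haddC haddA. Qed.

(** After rotating the second sum once and the third twice, the summands at each [(x, y, z)] are the
    three rotations of [T (f x) (g y) (h z)], to which the Jacobi hypothesis applies. *)
Lemma cycsum_jacobi (T : A -> A -> A -> A) (Q f g h : A -> A) :
    (forall x y z, T x y z + T y z x + T z x y = Q x + Q y + Q z) ->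
  cycsum (fun x y z => T (f x) (g y) (h z))
    + cycsum (fun x y z => T (g x) (h y) (f z))
    + cycsum (fun x y z => T (h x) (f y) (g z))
  = cycsum (fun x _ _ => Q (f x)) + cycsum (fun x _ _ => Q (g x))
    + cycsum (fun x _ _ => Q (h x)).
Proof.
move=> jac.
rewrite -(cycsum_rot (fun x y z => T (g x) (h y) (f z))).
rewrite -(cycsum_rot (fun x y z => T (h x) (f y) (g z))).
rewrite -(cycsum_rot (fun x y z => T (h y) (f z) (g x))).
rewrite -(cycsum_rot (fun x _ _ => Q (g x))).
rewrite -(cycsum_rot (fun x _ _ => Q (h x))).
rewrite -(cycsum_rot (fun _ z _ => Q (h z))).
by rewrite -!cycsumD; apply: eq_cycsum => x y z; rewrite jac.
Qed.

End CyclicSum.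
End HeapRetract.

Lemma heap_interchange (A : abelianHeapType) (a1 a2 a3 b1 b2 b3 c1 c2 c3 : A) :
  heap (heap a1 a2 a3) (heap b1 b2 b3) (heap c1 c2 c3) =
  heap (heap a1 b1 c1) (heap a2 b2 c2) (heap a3 b3 c3).
Proof.
have o := a1; have B := haddB o.
set x := heap a1 a2 a3; set y := heap b1 b2 b3; set z := heap c1 c2 c3.
set u := heap a1 b1 c1; set v := heap a2 b2 c2; set w := heap a3 b3 c3.
(* Both sides are alternating sums of the nine entries. Adding [y], [a2] and [c2] clears the signs
   on the left; on the right [a2 + c2 = v + b2] cancels [v], and [y + b2 = b1 + b3]. *)
apply: (@haddIr _ o (hadd o y (hadd o a2 c2))).
transitivity (hadd o (hadd o a1 a3) (hadd o c1 c3)).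
  by rewrite haddA B haddACA (B a1) (B c1).
rewrite -(B a2 b2 c2) -/v (haddC o v) (haddA o y) (haddC o _ v).
by rewrite (haddA o (heap _ _ _)) (B u) (B b1) (haddACA o u)
  (B a1) (B a3) haddACA.
Qed.

(** By [act_base] everything moves to the base point [a1], where the action is a heap morphism in
    its last argument. *)
Lemma act_heap (K : comPzRingType) (A : affModType K) (x : K)
    (a1 a2 a3 b1 b2 b3 : A) :
  act x (heap a1 a2 a3) (heap b1 b2 b3) =
  heap (act x a1 b1) (act x a2 b2) (act x a3 b3).
Proof.
rewrite (act_base x _ _ a1) !act_heapr heap_interchange.
by rewrite -!act_base.
Qed.

Section AffineMaps.
Variables (K : comPzRingType) (A B : affModType K).

Lemma affine_comp (C : affModType K) (g : B -> C) (f : A -> B) :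
  affine_map g -> affine_map f -> affine_map (g \o f).
Proof.
by move=> [gh ga] [fh fa]; split=> [x y z|k x y] /=; rewrite ?fh ?gh ?fa ?ga.
Qed.

Lemma affine_heap (f g h : A -> B) :
    affine_map f -> affine_map g -> affine_map h ->
  affine_map (fun x => heap (f x) (g x) (h x)).
Proof.
move=> [fh fa] [gh ga] [hh ha]; split=> [x y z|k x y].
  by rewrite fh gh hh heap_interchange.
by rewrite fa ga ha act_heap.
Qed.

End AffineMaps.

Section NijenhuisBracket.
Variables (K : comPzRingType) (A : affModType K).
Variables (br : A -> A -> A) (N : A -> A).
Hypotheses (br_lie : lie_bracket br) (N_nij : nijenhuis_operator br N).

Lemma nijenhuis_bracket_biaffine : biaffine (nijenhuis_bracket br N).
Proof.
have [[brl brr] _ _] := br_lie; have [Naff _] := N_nij.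
split=> x; apply: affine_heap => //.
- exact: (affine_comp Naff (brl x)).
- exact: (affine_comp (brl x) Naff).
- exact: (affine_comp (brr x) Naff).
- exact: (affine_comp Naff (brr x)).
Qed.

Section Additive.
Variable o : A.
Local Notation "x + y" := (hadd o x y).

Lemma heap_morphD (f : A -> A) x y z w :
  heap_morphism heap heap f -> x + z = w + y -> f x + f z = f w + f y.
Proof. by move=> fh /(heapP o x y z w) <-; rewrite fh haddB. Qed.

Lemma lie_bracketD x y : br x y + br y x = br x x + br y y.
Proof.
have [_ antisym _] := br_lie.
by have /(heapP o) -> := antisym x y; rewrite haddC.
Qed.

Lemma nijenhuis_bracketD x y :
  nijenhuis_bracket br N x y + N (br x y) = br (N x) y + br x (N y).
Proof. exact: haddB. Qed.

Lemma heap_morph_jacobi (f : A -> A) x y z :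
    heap_morphism heap heap f ->
  f (br x (br y z)) + f (br y (br z x)) + f (br z (br x y))
  = f (br x x) + f (br y y) + f (br z z).
Proof.
move=> fh; have [_ _ jac] := br_lie.
have := congr1 f (jac x y z); rewrite {1}/heap5 !fh => /(heap5P o) ->.
by rewrite -haddA haddC.
Qed.

Lemma nijenhuis_bracket2D x y z :
  nijenhuis_bracket br N x (nijenhuis_bracket br N y z)
    + (N (br (N x) (br y z)) + N (br x (br y (N z))) + N (br x (br (N y) z)))
  = br (N x) (br (N y) z) + br (N x) (br y (N z)) + br x (br (N y) (N z))
    + N (N (br x (br y z))).
Proof.
have [[brl _] _ _] := br_lie; have [[Nh _] Nij] := N_nij.
(* The Nijenhuis identity enters twice: [N v] is [br (N y) (N z)], and [N] of the new bracket of [x]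
   and [u] is [br (N x) (N u)]. The remaining terms in [v] or [N u] then cancel. *)
set u := br y z; set v := nijenhuis_bracket br N y z.
have xD := nijenhuis_bracketD x v; rewrite -(Nij y z) in xD.
have vD := nijenhuis_bracketD y z; rewrite -/u -/v in vD.
have xvD := heap_morphD (brl x).1 vD.
have NxvD := heap_morphD Nh xvD.
have NxD := heap_morphD (brl (N x)).1 vD.
have NuD := heap_morphD Nh (nijenhuis_bracketD x u); rewrite -Nij in NuD.
rewrite -haddA (haddC o (N (br x (br y (N z))))) -NxvD.
rewrite (haddC o (N (br (N x) u))) -(haddA o (N (br x v))).
rewrite (haddC o _ (N (br (N x) u))) -NuD (haddA o _ (N (br x v))) xD.
by rewrite haddACA NxD haddA.
Qed.

Lemma nijenhuis_cycsum a b c :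
  cycsum o a b c
    (fun x y z => nijenhuis_bracket br N x (nijenhuis_bracket br N y z))
  = cycsum o a b c (fun x _ _ => nijenhuis_bracket br N x x).
Proof.
have [[Nh _] Nij] := N_nij.
pose S f := cycsum o a b c (fun x _ _ : A => f x).
pose q x := br x x; pose p x := br (N x) (N x).
have idh : heap_morphism heap heap (@id A) by [].
(* [MNL] collects the terms with two slots under an inner [N], [VTS] those with one slot under an
   inner [N] and one outer [N]. *)
have MNL := cycsum_jacobi a b c N N id
  (fun x y z => heap_morph_jacobi x y z idh).
have VTS := cycsum_jacobi a b c N id id
  (fun x y z => heap_morph_jacobi x y z Nh).
rewrite /= -/(S q) -/(S p) -/(S (N \o q)) -/(S (N \o p)) in MNL VTS.
have DQ : S (fun x => nijenhuis_bracket br N x x) + S (N \o q) = S p + S q.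
  rewrite -!cycsumD; apply: eq_cycsum => x y z.
  by rewrite nijenhuis_bracketD (lie_bracketD (N x) x).
have PR : S p + S (N \o N \o q) = S (N \o p) + S (N \o q).
  rewrite -!cycsumD; apply: eq_cycsum => x y z; rewrite /p Nij /=.
  rewrite (heap_morphD Nh (nijenhuis_bracketD x x)).
  exact: (heap_morphD Nh (lie_bracketD (N x) x)).
have NNt :
    cycsum o a b c (fun x y z => N (N (br x (br y z)))) = S (N \o N \o q).
  by apply: (@heap_morph_jacobi (N \o N)) => x y z /=; rewrite !Nh.
have := eq_cycsum o a b c nijenhuis_bracket2D.
rewrite !cycsumD VTS MNL NNt => E.
(* The added sum is the left-hand remainder in [E]: [PR] trades one part of it for [S p] and
   [S (N \o N \o q)], and [DQ] absorbs the rest. *)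
apply: (@haddIr _ o (S (N \o p) + S (N \o q) + S (N \o q))); rewrite E.
rewrite -PR (haddC o _ (S (N \o q))) (haddA o _ (S (N \o q))) DQ.
by rewrite (haddAC o (S p)) -haddA.
Qed.

End Additive.

Lemma nijenhuis_bracket_antisym a b :
  heap (nijenhuis_bracket br N a b) (nijenhuis_bracket br N a a)
       (nijenhuis_bracket br N b a)
  = nijenhuis_bracket br N b b.
Proof.
pose o := a; have [[Nh _] _] := N_nij.
have D := nijenhuis_bracketD o; have C := lie_bracketD o.
apply/(heapP o); rewrite [RHS]haddC.
(* Antisymmetry of [br] under [N] lets this term complete both sides to the form of
   [nijenhuis_bracketD]; each then equals the sum of [br t t] over [t] among [a], [b], [N a],
   [N b]. *)
apply: (@haddIr _ o (hadd o (N (br a a)) (N (br b b)))).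
rewrite -{1}(heap_morphD Nh (C a b)) [LHS]haddACA [RHS]haddACA.
by rewrite !D (haddC o (br (N b) a)) haddACA !C [LHS]haddC
  [LHS]haddACA (haddC o (br a a)).
Qed.

End NijenhuisBracket.

Theorem theorem4p3 (K : comPzRingType) (A : affModType K) (br : A -> A -> A)
    (N : A -> A) (br_lie : lie_bracket br)
    (N_nij : nijenhuis_operator br N) :
  lie_bracket (nijenhuis_bracket br N).
Proof.
split.
- exact: nijenhuis_bracket_biaffine.
- exact: nijenhuis_bracket_antisym.
move=> a b c; apply/(heap5P a _ _ _ _ _ _); rewrite -[RHS]haddA [RHS]haddC.
(* The first [a] is the origin, an arbitrary choice. *)
exact: (nijenhuis_cycsum br_lie N_nij a a b c).
Qed.
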